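(* Let $\mathbb{Q}^{ia}=I(\Sigma_{iamd},E_{iamd})$ be the initial algebra among all algebras over the signature $\Sigma_{iamd}=\{1,+,\cdot,{}^{-1}\}$ that satisfy the axioms $E_{iamd}$ of inversive arithmetical meadows. Then $\mathbb{Q}^{ia}$ is (up to isomorphism) the subalgebra of the $\Sigma_{iamd}$-reduct of $\mathbb{Q}_0^{i}$ whose domain is the set of all positive rational numbers, where $\mathbb{Q}_0^{i}$ is the inversive meadow of rational numbers.
   Context: $E_{iamd}$ consists of the equations (universally quantified) $(x+y)+z=x+(y+z)$, $x+y=y+x$, $(x\cdot y)\cdot z=x\cdot(y\cdot z)$, $x\cdot y=y\cdot x$, $x\cdot 1=x$, $x\cdot(y+z)=x\cdot y+x\cdot z$, and $x\cdot x^{-1}=1$. Here $1$ is a constant, $+,\cdot$ are binary and ${}^{-1}$ is unary. $I(\Sigma,E)$ denotes the initial algebra in the class of all $\Sigma$-algebras satisfying $E$, equivalently the closed $\Sigma$-terms modulo provable equality from $E$; it is determined up to isomorphism. $\mathbb{Q}_0^{i}$ is the zero-totalized field of rational numbers: the algebra over $\{0,1,+,\cdot,-,{}^{-1}\}$ that is the field of rational numbers with $q^{-1}$ the usual inverse for $q\neq 0$ and $0^{-1}=0$. The $\Sigma_{iamd}$-reduct is obtained by forgetting $0$ and $-$. *)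

(* Defs.v *)
From HB Require Import structures.
From mathcomp Require Import all_boot all_order all_algebra.
From mathcomp Require Import boolp.

Set Implicit Arguments.
Unset Strict Implicit.
Unset Printing Implicit Defensive.

Import Order.TTheory GRing.Theory Num.Theory.

Record signature := Signature {
  op : Type;
  arity : op -> nat }.

Record algebra (S : signature) := Algebra {
  carrier :> Type;
  interp : forall o : op S, ('I_(arity o) -> carrier) -> carrier }.
Arguments interp {S} A o a : rename.

Definition is_hom (S : signature) (A B : algebra S) (h : A -> B) : Prop :=
  forall (o : op S) (a : 'I_(arity o) -> A),
    h (interp A o a) = interp B o (fun i => h (a i)).

Definition isomorphic (S : signature) (A B : algebra S) : Prop :=
  exists h : A -> B, is_hom h /\ bijective h.

Inductive term (S : signature) (V : Type) :=
| Var (v : V)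
| Op (o : op S) (a : 'I_(arity o) -> term S V).
Arguments Var {S V} v.
Arguments Op {S V} o a.

Fixpoint subst (S : signature) (V W : Type) (s : V -> term S W)
    (t : term S V) : term S W :=
  match t with
  | Var v => s v
  | Op o a => Op o (fun i => subst s (a i))
  end.

Fixpoint eval (S : signature) (A : algebra S) (V : Type) (e : V -> A)
    (t : term S V) : A :=
  match t with
  | Var v => e v
  | Op o a => interp A o (fun i => eval e (a i))
  end.

(* A set of equations [l = r], the variables being implicitly universally
   quantified. *)
Definition equations (S : signature) := term S nat -> term S nat -> Prop.

Definition satisfies (S : signature) (E : equations S) (A : algebra S) : Prop :=
  forall l r, E l r -> forall e : nat -> A, eval e l = eval e r.

Definition is_initial (S : signature) (E : equations S) (A : algebra S) : Prop :=
  satisfies E A /\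
  forall B : algebra S, satisfies E B -> exists! h : A -> B, is_hom h.

(* Equational logic. Between closed terms ([V = void]) only closed instances
   of the axioms are used; this loses nothing, since in a derivation between
   two closed terms any remaining variable can be replaced by a closed term. *)
Inductive provable (S : signature) (E : equations S) (V : Type) :
    term S V -> term S V -> Prop :=
| provable_axiom l r (s : nat -> term S V) :
    E l r -> provable E (subst s l) (subst s r)
| provable_refl t : provable E t t
| provable_sym t u : provable E t u -> provable E u t
| provable_trans t u v : provable E t u -> provable E u v -> provable E t v
| provable_congr o (a b : 'I_(arity o) -> term S V) :
    (forall i, provable E (a i) (b i)) -> provable E (Op o a) (Op o b).

Definition closed_term (S : signature) := term S void.
HB.instance Definition _ (S : signature) := gen_eqMixin (closed_term S).
HB.instance Definition _ (S : signature) := gen_choiceMixin (closed_term S).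

Section InitialAlgebra.
Variables (S : signature) (E : equations S).
Local Open Scope quotient_scope.

Definition provably_equal : rel (closed_term S) :=
  fun t u => `[< provable E t u >].

Lemma provably_equal_equiv : equiv_class_of provably_equal.
Proof.
split.
- by move=> t; apply/asboolP; exact: provable_refl.
- by move=> t u; apply/asboolP/asboolP; exact: provable_sym.
- move=> t u v /asboolP ut /asboolP tv; apply/asboolP.
  exact: provable_trans ut tv.
Qed.

Canonical provably_equal_equivRel := EquivRelPack provably_equal_equiv.

Local Notation Q := {eq_quot provably_equal}.

(* I(S, E): the closed terms modulo provable equality *)
Definition initial_algebra : algebra S :=
  @Algebra S Q
    (fun o a => \pi_Q (Op o (fun i => repr (a i)))).

Lemma pi_provable (t u : closed_term S) :
  \pi_Q t = \pi_Q u <-> provable E t u.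
Proof.
split; first by move/eqquotP/asboolP.
by move=> tu; apply/eqquotP/asboolP.
Qed.

Lemma repr_provable (t : closed_term S) :
  provable E (repr (\pi_Q t)) t.
Proof. by apply/pi_provable; rewrite reprK. Qed.

Lemma interp_pi (o : op S) (a : 'I_(arity o) -> closed_term S) :
  interp initial_algebra o (fun i => \pi_Q (a i)) = \pi_Q (Op o a).
Proof.
apply/pi_provable; apply: provable_congr => i; exact: repr_provable.
Qed.

Lemma eval_pi (V : Type) (s : V -> closed_term S) (t : term S V) :
  eval (A := initial_algebra) (fun v => \pi_Q (s v)) t = \pi_Q (subst s t).
Proof.
elim: t => [//|o a IH].
rewrite -[RHS](interp_pi (fun i => subst s (a i))).
by apply: (congr1 (interp _ o)); exact: funext.
Qed.

Lemma eval_subst (A : algebra S) (V W : Type) (s : V -> term S W) (e : W -> A)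
    (t : term S V) :
  eval e (subst s t) = eval (fun v => eval e (s v)) t.
Proof.
by elim: t => [//|o a IH] /=; apply: (congr1 (interp _ o)); exact: funext.
Qed.

Lemma provable_sound (A : algebra S) (V : Type) (e : V -> A) (t u : term S V) :
  satisfies E A -> provable E t u -> eval e t = eval e u.
Proof.
move=> AE; elim=> {t u} [l r s lr|//|t u _ ->//|t u v _ -> _ ->//|o a b _ IH] /=.
- by rewrite !eval_subst; exact: AE.
- by apply: (congr1 (interp _ o)); exact: funext.
Qed.

Lemma initial_algebraP : is_initial E initial_algebra.
Proof.
split=> [l r lr e|B BE].
  have -> : e = (fun v => \pi_Q (repr (e v))) by apply: funext => v; rewrite reprK.
  by rewrite !eval_pi; apply/pi_provable; exact: provable_axiom.
pose ev := eval (A := B) (fun v : void => match v with end).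
exists (fun q : initial_algebra => ev (repr q)); split.
  move=> o a; rewrite /ev /=.
  exact: (provable_sound _ BE (repr_provable _)).
move=> h hh; apply: funext => q; rewrite -[in RHS](reprK q).
elim: (repr q) => [[]|o a IH]; rewrite -interp_pi hh /ev /=.
by apply: (congr1 (interp _ o)); exact: funext.
Qed.

End InitialAlgebra.

Record signature_map (S T : signature) := SignatureMap {
  map_op :> op S -> op T;
  arity_map_op : forall o, arity (map_op o) = arity o }.

Definition reduct (S T : signature) (f : signature_map S T) (A : algebra T) :
    algebra S :=
  @Algebra S A
    (fun o a => interp A (f o) (fun i => a (cast_ord (arity_map_op f o) i))).

Definition subuniverse (S : signature) (A : algebra S) (P : A -> Prop) : Prop :=
  forall (o : op S) (a : 'I_(arity o) -> A),
    (forall i, P (a i)) -> P (interp A o a).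

Definition subalgebra (S : signature) (A : algebra S) (P : A -> Prop)
    (clP : subuniverse P) : algebra S :=
  @Algebra S {x : A | P x}
    (fun o a => exist P (interp A o (fun i => sval (a i)))
                        (clP o _ (fun i => svalP (a i)))).

Definition args0 (X : Type) : 'I_0 -> X :=
  fun i => match notF (ltn_ord i) with end.
Definition args1 (X : Type) (x : X) : 'I_1 -> X := fun _ => x.
Definition args2 (X : Type) (x y : X) : 'I_2 -> X :=
  fun i => if i == ord0 then x else y.

Variant iamd_op := IOne | IAdd | IMul | IInv.

Definition sig_iamd : signature :=
  Signature (fun o => match o with
                      | IOne => 0 | IInv => 1 | IAdd | IMul => 2
                      end).

Variant imd_op := MZero | MOne | MAdd | MMul | MOpp | MInv.

Definition sig_imd : signature :=
  Signature (fun o => match o with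
                      | MZero | MOne => 0
                      | MOpp | MInv => 1
                      | MAdd | MMul => 2
                      end).

Definition iamd_imd : signature_map sig_iamd sig_imd :=
  @SignatureMap sig_iamd sig_imd
    (fun o => match o with
              | IOne => MOne | IAdd => MAdd | IMul => MMul | IInv => MInv
              end)
    (fun o => match o with
              | IOne | IAdd | IMul | IInv => erefl
              end).

Section Equations.
Let tm := term sig_iamd nat.
Let x : tm := Var 0.
Let y : tm := Var 1.
Let z : tm := Var 2.
Local Notation "1" := (Op (S := sig_iamd) IOne (@args0 tm)).
Local Notation "s + t" := (Op (S := sig_iamd) IAdd (args2 s t)).
Local Notation "s * t" := (Op (S := sig_iamd) IMul (args2 s t)).
Local Notation "s ^-1" := (Op (S := sig_iamd) IInv (args1 s)).

Variant E_iamd : equations sig_iamd :=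
| iamd_addA : E_iamd ((x + y) + z) (x + (y + z))
| iamd_addC : E_iamd (x + y) (y + x)
| iamd_mulA : E_iamd ((x * y) * z) (x * (y * z))
| iamd_mulC : E_iamd (x * y) (y * x)
| iamd_mul1 : E_iamd (x * 1) x
| iamd_mulD : E_iamd (x * (y + z)) (x * y + x * z)
| iamd_mulV : E_iamd (x * x^-1) 1.
End Equations.

Local Open Scope ring_scope.

(* The inverse on [rat] is already zero-totalized: [0^-1 = 0] by [invr0]. *)
Definition Q0i : algebra sig_imd :=
  @Algebra sig_imd rat
    (fun o => match o return ('I_(arity (s := sig_imd) o) -> rat) -> rat with
              | MZero => fun _ => 0
              | MOne => fun _ => 1
              | MAdd => fun a => a ord0 + a ord_max
              | MMul => fun a => a ord0 * a ord_max
              | MOpp => fun a => - a ord0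
              | MInv => fun a => (a ord0)^-1
              end).

Definition Qia : algebra sig_iamd := initial_algebra E_iamd.

Definition positive (q : reduct iamd_imd Q0i) : Prop := 0 < (q : rat).

(* Main.v *)
(** In every inversive arithmetical meadow the numerals [1 + ... + 1] compute
    like positive integers and all elements are invertible, so fractions of
    numerals add, multiply and invert as positive rationals do.  This gives a
    homomorphism [g] from the positive rationals to any model, in particular to
    the initial algebra.  If [h] is the homomorphism provided by initiality then
    [g \o h = id] by uniqueness, and [h \o g = id] because homomorphisms preserve
    fractions of numerals. *)
From mathcomp Require Import all_boot all_order all_algebra.
From mathcomp Require Import boolp.
Require Import Defs.

Set Implicit Arguments.
Unset Strict Implicit.
Unset Printing Implicit Defensive.

Import Order.TTheory GRing.Theory Num.Theory.

(** * Argument tuples of arity 0, 1 and 2 *)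

Lemma args0E (X : Type) (a : 'I_0 -> X) : a = @args0 X.
Proof. by apply: funext => -[]. Qed.

Lemma args1E (X : Type) (a : 'I_1 -> X) : a = args1 (a ord0).
Proof. by apply: funext => i; rewrite (ord1 i). Qed.

Lemma args2E (X : Type) (a : 'I_2 -> X) : a = args2 (a ord0) (a ord_max).
Proof.
apply: funext => i; rewrite /args2; case: eqP => [-> //|i_neq0].
congr a; apply: val_inj; case: i i_neq0 => -[|[|//]] lti // i_neq0.
by case: i_neq0; apply: val_inj.
Qed.

(** * Arithmetic of numerals and fractions in a model of the axioms *)

Section IAMD.
Variable A : algebra sig_iamd.

Definition one : A := interp A IOne (@args0 A).
Definition add (x y : A) : A := interp A IAdd (args2 x y).
Definition mul (x y : A) : A := interp A IMul (args2 x y).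
Definition inv (x : A) : A := interp A IInv (args1 x).

Lemma interp_one a : interp A IOne a = one.
Proof. by rewrite [a]args0E. Qed.

Lemma interp_add a : interp A IAdd a = add (a ord0) (a ord_max).
Proof. by rewrite [a in LHS]args2E. Qed.

Lemma interp_mul a : interp A IMul a = mul (a ord0) (a ord_max).
Proof. by rewrite [a in LHS]args2E. Qed.

Lemma interp_inv a : interp A IInv a = inv (a ord0).
Proof. by rewrite [a in LHS]args1E. Qed.

(** Evaluation yields arbitrary argument functions; these rules bring them back to the named
    operations. *)
Definition interpE := (interp_one, interp_add, interp_mul, interp_inv).

Lemma satisfies_iamd :
    associative add -> commutative add -> associative mul -> commutative mul ->
    right_id one mul -> right_distributive mul add ->
    (forall x, mul x (inv x) = one) ->
  satisfies E_iamd A.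
Proof.
by move=> addA addC mulA mulC mul1 mulD mulV l r [] e;
  rewrite /= !interpE /= ?interpE.
Qed.

(* The numeral of [n > 0]; [num 0] is a junk value. *)
Definition num (n : nat) : A := iter n.-1 (add one) one.
Definition frac (m n : nat) : A := mul (num m) (inv (num n)).

Lemma numS n : num n.+2 = add one (num n.+1).
Proof. by []. Qed.

Hypothesis AE : satisfies E_iamd A.

(** Variables 0 and 1 go to [x] and [y]; the default value of [nth] sends variable 2 to [z]. *)
Let env (x y z : A) : nat -> A := nth z [:: x; y].

Lemma addA x y z : add (add x y) z = add x (add y z).
Proof. by have := AE iamd_addA (env x y z); rewrite /= !interpE /= !interpE. Qed.

Lemma mulA x y z : mul (mul x y) z = mul x (mul y z).
Proof. by have := AE iamd_mulA (env x y z); rewrite /= !interpE /= !interpE. Qed.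

Lemma mulC x y : mul x y = mul y x.
Proof. by have := AE iamd_mulC (env x y y); rewrite /= !interpE. Qed.

Lemma mul1 x : mul x one = x.
Proof. by have := AE iamd_mul1 (env x x x); rewrite /= !interpE /= !interpE. Qed.

Lemma mulD x y z : mul x (add y z) = add (mul x y) (mul x z).
Proof. by have := AE iamd_mulD (env x y z); rewrite /= !interpE /= !interpE. Qed.

Lemma mulV x : mul x (inv x) = one.
Proof. by have := AE iamd_mulV (env x x x); rewrite /= !interpE /= !interpE. Qed.

Lemma mulACA x y z t : mul (mul x y) (mul z t) = mul (mul x z) (mul y t).
Proof. by rewrite !mulA -(mulA y) (mulC y) mulA. Qed.

Lemma mulIl x y z : mul x z = mul y z -> x = y.
Proof.
by move=> xz_yz; rewrite -[x]mul1 -[y]mul1 -(mulV z) -!mulA xz_yz.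
Qed.

(** Cancel [x]. The laws for inverses of products and of inverses, absent from the axioms, follow
    from this. *)
Lemma inv_uniq x y : mul x y = one -> inv x = y.
Proof. by move=> xy1; apply: (@mulIl _ _ x); rewrite mulC mulV mulC xy1. Qed.

Lemma invM x y : inv (mul x y) = mul (inv x) (inv y).
Proof. by apply: inv_uniq; rewrite mulACA !mulV mul1. Qed.

Lemma invK x : inv (inv x) = x.
Proof. by apply: inv_uniq; rewrite mulC mulV. Qed.

Lemma numD m n : 0 < m -> 0 < n -> num (m + n) = add (num m) (num n).
Proof.
case: m n => [|m] // [|n] // _ _; elim: m => [//|m IHm].
by rewrite addSn numS addA -IHm.
Qed.

Lemma numM m n : 0 < m -> 0 < n -> num (m * n) = mul (num m) (num n).
Proof.
move=> m_gt0; case: n => // n _; elim: n => [|n IHn].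
  by rewrite muln1 mul1.
by rewrite mulnS numD ?muln_gt0 ?m_gt0 // IHn -{1}[num m]mul1 -mulD.
Qed.

Lemma fracM m n p q : 0 < m -> 0 < n -> 0 < p -> 0 < q ->
  mul (frac m n) (frac p q) = frac (m * p) (n * q).
Proof. by move=> *; rewrite /frac !numM // invM mulACA. Qed.

Lemma fracV m n : inv (frac m n) = frac n m.
Proof. by rewrite /frac invM invK mulC. Qed.

Lemma fracK m n : mul (frac m n) (num n) = num m.
Proof. by rewrite mulA (mulC (inv _)) mulV mul1. Qed.

(** Multiplying by the common denominator [num (n * q)] turns both sides into numerals, and [mulIl]
    cancels it. The same device proves [fracD]. *)
Lemma frac_eq m n p q : 0 < m -> 0 < n -> 0 < p -> 0 < q ->
  m * q = p * n -> frac m n = frac p q.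
Proof.
move=> m0 n0 p0 q0 mq_pn; apply: (@mulIl _ _ (num (n * q))).
rewrite {1}numM // -mulA fracK mulnC numM // -mulA fracK.
by rewrite -!numM // mq_pn.
Qed.

Lemma fracD m n p q : 0 < m -> 0 < n -> 0 < p -> 0 < q ->
  add (frac m n) (frac p q) = frac (m * q + p * n) (n * q).
Proof.
move=> m0 n0 p0 q0; apply: (@mulIl _ _ (num (n * q))).
rewrite fracK mulC mulD mulC (mulC (num _) (frac p q)).
rewrite {1}numM // -mulA fracK mulnC numM // -mulA fracK.
by rewrite -!numM // -numD // muln_gt0 ?m0 ?p0.
Qed.

End IAMD.

Arguments one : simpl never.
Arguments add : simpl never.
Arguments mul : simpl never.
Arguments inv : simpl never.

(** * Homomorphisms preserve fractions of numerals *)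

Section Hom.
Variables (A B : algebra sig_iamd) (h : A -> B).
Hypothesis h_hom : is_hom h.

Lemma hom_one : h (one A) = one B.
Proof. by rewrite /one h_hom interpE. Qed.

Lemma hom_add x y : h (add x y) = add (h x) (h y).
Proof. by rewrite /add h_hom interpE. Qed.

Lemma hom_mul x y : h (mul x y) = mul (h x) (h y).
Proof. by rewrite /mul h_hom interpE. Qed.

Lemma hom_inv x : h (inv x) = inv (h x).
Proof. by rewrite /inv h_hom interpE. Qed.

Lemma hom_num n : h (num A n) = num B n.
Proof.
rewrite /num; elim: n.-1 => [|k IHk] /=; first exact: hom_one.
by rewrite hom_add hom_one IHk.
Qed.

Lemma hom_frac m n : h (frac A m n) = frac B m n.
Proof. by rewrite hom_mul hom_inv !hom_num. Qed.

End Hom.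

(** * The algebra of positive rationals as a model *)

Local Open Scope ring_scope.

Lemma positive_closed : subuniverse positive.
Proof.
case=> a a_gt0; rewrite /positive /=.
- exact: ltr01.
- by rewrite addr_gt0 ?a_gt0 //; exact: a_gt0.
- by rewrite mulr_gt0 //; exact: a_gt0.
- by rewrite invr_gt0; exact: a_gt0.
Qed.

Definition Qpos : algebra sig_iamd := subalgebra positive_closed.

Definition qval (x : Qpos) : rat := sval x.

Lemma qval_inj : injective qval.
Proof. by move=> [x x_gt0] [y y_gt0] xy; apply: eq_exist. Qed.

Lemma qval_gt0 x : 0 < qval x.
Proof. exact: svalP x. Qed.

Lemma qval_one : qval (one Qpos) = 1.
Proof. by []. Qed.

Lemma qval_add x y : qval (add x y) = qval x + qval y.
Proof. by []. Qed.

Lemma qval_mul x y : qval (mul x y) = qval x * qval y.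
Proof. by []. Qed.

Lemma qval_inv x : qval (inv x) = (qval x)^-1.
Proof. by []. Qed.

Definition qvalE := (qval_one, qval_add, qval_mul, qval_inv).

Lemma qval_num n : (0 < n)%N -> qval (num Qpos n) = n%:R.
Proof.
case: n => // n _; elim: n => [//|n IHn].
by rewrite numS !qvalE IHn nat1r.
Qed.

Lemma qval_frac m n : (0 < m)%N -> (0 < n)%N ->
  qval (frac Qpos m n) = m%:R / n%:R.
Proof. by move=> m0 n0; rewrite qval_mul qval_inv !qval_num. Qed.

Lemma Qpos_iamd : satisfies E_iamd Qpos.
Proof.
apply: satisfies_iamd => [x y z|x y|x y z|x y|x|x y z|x]; apply: qval_inj.
- by rewrite !qvalE addrA.
- by rewrite !qvalE addrC.
- by rewrite !qvalE mulrA.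
- by rewrite !qvalE mulrC.
- by rewrite !qvalE mulr1.
- by rewrite !qvalE mulrDr.
(* Positivity enters here: the law fails at 0, where [0^-1 = 0]. *)
- by rewrite !qvalE mulfV // gt_eqF ?qval_gt0.
Qed.

Lemma posrat_frac (q : rat) : 0 < q ->
  [/\ (0 < `|numq q|)%N, (0 < `|denq q|)%N
    & q = `|numq q|%:R / `|denq q|%:R].
Proof.
move=> q_gt0; rewrite !absz_gt0 numq_eq0 gt_eqF // denq_neq0; split=> //.
by rewrite !natr_absz !gtr0_norm ?numq_gt0 ?denq_gt0 // divq_num_den.
Qed.

(** * The homomorphism from the positive rationals to any model *)

Section FromQpos.
Variable A : algebra sig_iamd.
Hypothesis AE : satisfies E_iamd A.

Definition of_Qpos (x : Qpos) : A := frac A `|numq (qval x)| `|denq (qval x)|.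

Lemma of_QposE x m n : (0 < m)%N -> (0 < n)%N -> qval x = m%:R / n%:R ->
  of_Qpos x = frac A m n.
Proof.
move=> m0 n0 xE; have [p0 q0 /eqP] := posrat_frac (qval_gt0 x).
(* Equality of the two rational fractions becomes cross-multiplication in the naturals, as [frac_eq]
   requires. *)
rewrite {1}xE eqr_div ?pnatr_eq0 -?lt0n // -!natrM eqr_nat => /eqP e.
by apply: (frac_eq AE).
Qed.

Lemma of_Qpos_hom : is_hom of_Qpos.
Proof.
case=> a; rewrite !interpE.
- by rewrite (@of_QposE _ 1 1) ?qvalE ?divr1 // /frac mulV.
- have [p0 q0 xE] := posrat_frac (qval_gt0 (a ord0)).
  have [m0 n0 yE] := posrat_frac (qval_gt0 (a ord_max)).
  (* The fraction given by [fracD] need not be reduced; [of_QposE] only asks that its value be the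
     rational sum. *)
  rewrite /of_Qpos (fracD AE) //; apply: of_QposE;
    rewrite ?addn_gt0 ?muln_gt0 ?p0 ?q0 ?n0 //.
  rewrite qval_add {1}xE {1}yE addf_div ?pnatr_eq0 -?lt0n //.
  by rewrite natrD !natrM.
- have [p0 q0 xE] := posrat_frac (qval_gt0 (a ord0)).
  have [m0 n0 yE] := posrat_frac (qval_gt0 (a ord_max)).
  rewrite /of_Qpos (fracM AE) //; apply: of_QposE;
    rewrite ?muln_gt0 ?p0 ?q0 //.
  by rewrite qval_mul {1}xE {1}yE mulf_div !natrM.
- have [p0 q0 xE] := posrat_frac (qval_gt0 (a ord0)).
  rewrite /of_Qpos (fracV AE); apply: of_QposE => //.
  by rewrite qval_inv {1}xE invf_div.
Qed.

End FromQpos.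

(** * The isomorphism *)

Lemma comp_hom (S : signature) (A B C : algebra S) (g : B -> C) (f : A -> B) :
  is_hom g -> is_hom f -> is_hom (g \o f).
Proof. by move=> gh fh o a /=; rewrite fh gh. Qed.

Theorem theorem3 :
  exists positive_closed : subuniverse positive,
    isomorphic Qia (subalgebra positive_closed).
Proof.
exists positive_closed.
have [QE Qinit] := initial_algebraP E_iamd.
have [h [h_hom _]] := Qinit Qpos Qpos_iamd.
have g_hom := of_Qpos_hom QE.
exists h; split=> //; exists (of_Qpos Qia) => [x|y].
  (* Initiality of [Qia] towards itself: [of_Qpos Qia \o h] and [id] both equal the unique
     endomorphism [k]. *)
  have [k [_ kU]] := Qinit _ QE.
  have /kU k_gh := comp_hom g_hom h_hom.
  have /kU k_id : is_hom (@id Qia) by [].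
  by have := congr1 (@^~ x) k_gh; rewrite k_id.
(* [h] sends the fraction [of_Qpos Qia y] to the same fraction in [Qpos], whose value is that of
   [y]. *)
apply: qval_inj; rewrite (hom_frac h_hom).
by have [p0 q0 {3}->] := posrat_frac (qval_gt0 y); rewrite qval_frac.
Qed.
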